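(* Let $k \ge 3$ and let $f$ be any $C^k$ globally concave globally acceptable MOC. Then for any $a > 0$ there exists a $C^{k+1}$ globally concave globally acceptable MOC $\overline{f}$, embedded in a $C^{k+1}$ globally concave globally acceptable continuous iteration group of MOC $(\overline{f}^t)_{t\in\mathbb{R}}$, with $\overline{f} > f$ on $(0,a)$. The associated function $\mu := \partial_t \overline{f}^t|_{t=0}$ is concave and $C^k$, and the generating function $h\colon\mathbb{R}\to(0,\infty)$, for which $\overline{f}^t(x) = h(t+h^{-1}(x))$ for all $t\in\mathbb{R}$, $x>0$, is $C^{k+1}$. Furthermore, if $f$ is strongly strictly concave (on $(0,\infty)$) then $\mu$ is strongly strictly concave on $(0,a)$.
   Context: A modulus of continuity (MOC) is a continuous function $f\colon[0,\infty)\to[0,\infty)$ with $f(0)=0$. A MOC is $C^k$ if it is continuous on $[0,\infty)$ and $C^k$ on $(0,\infty)$. A twice differentiable function $f$ is concave if $f''\le 0$ and strongly strictly concave if $f''<0$. For a function $f$ on $[0,\infty)$: $\iota(f) = \sup\{a\in[0,\infty] : f \text{ strictly increasing on } [0,a)\}$ and $V(f)=\sup\{a\in[0,\infty]: f\text{ concave on }(0,a)\}$. Let $f$ be a $C^1$ MOC with $f(x)>x$ for all $x\in(0,\infty)$, and let $J(f) = \iota(f(x)-x)$. Then $f$ is (globally) acceptable if $J(f)=\infty$ and locally acceptable if $J(f)>0$. A MOC is globally concave if it is concave on $(0,\infty)$. A continuous iteration group (CIG) of MOC is a family $G=(f^t)_{t\in\mathbb{R}}$ of MOC such that (1) for all $t>0$,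 $f^t(x)>x$ (for $x>0$); (2) $f^s\circ f^t=f^{s+t}$ for all $s,t\in\mathbb{R}$; (3) $f^0$ is the identity; (4) $t\mapsto f^t(x)$ is continuous for all $x\in[0,\infty)$. $G$ is locally acceptable if, for some $0<a<\infty$, for all $t>0$ the MOC $f^t$ is locally acceptable with $J(f^t)\ge f^{-t}(a)$; $J(G)$ is the supremum of all such $a$, and $G$ is globally acceptable if $J(G)=\infty$. $G$ is locally concave if, for some $0<a<\infty$, $V(f^t)\ge f^{-t}(a)$ for all $t>0$; $V(G)$ is the supremum of all such $a$, and $G$ is globally concave if $V(G)=\infty$. $G$ is $C^k$ if every $f^t$ is $C^k$. $f$ is embedded in $G$ if $f^1=f$. *)

(* Defs.v *)
From Stdlib Require Import Reals.
From Coquelicot Require Import Coquelicot.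

Open Scope R_scope.

(* A function on [0,oo) is represented by a total function R -> R whose
   values at negative reals are irrelevant. *)

Definition nonneg_reals (x : R) : Prop := 0 <= x.

Definition pos_reals (x : R) : Prop := 0 < x.

Definition interval_oo (a : R) (b : Rbar) (x : R) : Prop :=
  a < x /\ Rbar_lt x b.

(* To be used with D open.  The derivatives of order 1, ..., k exist on D (hence
   those of order < k are continuous) and the k-th one is continuous. *)
Definition Ck_on (k : nat) (D : R -> Prop) (f : R -> R) : Prop :=
  forall x, D x ->
    (forall j, (j <= k)%nat -> ex_derive_n f j x) /\
    continuous (Derive_n f k) x.

Definition twice_differentiable_on (D : R -> Prop) (f : R -> R) : Prop :=
  forall x, D x -> ex_derive_n f 1 x /\ ex_derive_n f 2 x.

Definition concave_on (D : R -> Prop) (f : R -> R) : Prop :=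
  twice_differentiable_on D f /\ forall x, D x -> Derive_n f 2 x <= 0.

Definition strongly_strictly_concave_on (D : R -> Prop) (f : R -> R) : Prop :=
  twice_differentiable_on D f /\ forall x, D x -> Derive_n f 2 x < 0.

(* [continuous_on nonneg_reals] is continuity relative to [0,oo): it is
   one-sided at 0. *)
Definition is_MOC (f : R -> R) : Prop :=
  continuous_on nonneg_reals f /\
  (forall x, 0 <= x -> 0 <= f x) /\
  f 0 = 0.

Definition Ck_half_line (k : nat) (f : R -> R) : Prop :=
  continuous_on nonneg_reals f /\ Ck_on k pos_reals f.

Definition is_Ck_MOC (k : nat) (f : R -> R) : Prop :=
  is_MOC f /\ Ck_half_line k f.

Definition strictly_increasing_before (f : R -> R) (a : Rbar) : Prop :=
  forall x y, 0 <= x -> x < y -> Rbar_lt y a -> f x < f y.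

Definition iota (f : R -> R) : Rbar :=
  Rbar_lub (fun a => Rbar_le 0 a /\ strictly_increasing_before f a).

Definition V (f : R -> R) : Rbar :=
  Rbar_lub (fun a => Rbar_le 0 a /\ concave_on (interval_oo 0 a) f).

Definition J (f : R -> R) : Rbar := iota (fun x => f x - x).

Definition expansive_C1_MOC (f : R -> R) : Prop :=
  is_Ck_MOC 1 f /\ forall x, 0 < x -> x < f x.

Definition globally_acceptable (f : R -> R) : Prop :=
  expansive_C1_MOC f /\ J f = p_infty.

Definition locally_acceptable (f : R -> R) : Prop :=
  expansive_C1_MOC f /\ Rbar_lt 0 (J f).

Definition globally_concave (f : R -> R) : Prop := concave_on pos_reals f.

(* [G t x] stands for f^t(x). *)
Record is_CIG (G : R -> R -> R) : Prop := {
  CIG_MOC : forall t, is_MOC (G t);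
  CIG_expansive : forall t x, 0 < t -> 0 < x -> x < G t x;
  CIG_comp : forall s t x, 0 <= x -> G s (G t x) = G (s + t) x;
  CIG_id : forall x, 0 <= x -> G 0 x = x;
  CIG_continuous : forall t x, 0 <= x -> continuous (fun s => G s x) t
}.

Definition is_Ck_CIG (k : nat) (G : R -> R -> R) : Prop :=
  is_CIG G /\ forall t, is_Ck_MOC k (G t).

Definition J_CIG (G : R -> R -> R) : Rbar :=
  Lub_Rbar (fun a => 0 < a /\
    forall t, 0 < t -> locally_acceptable (G t) /\ Rbar_le (G (- t) a) (J (G t))).

Definition V_CIG (G : R -> R -> R) : Rbar :=
  Lub_Rbar (fun a => 0 < a /\
    forall t, 0 < t -> Rbar_le (G (- t) a) (V (G t))).

Definition CIG_globally_acceptable (G : R -> R -> R) : Prop :=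
  J_CIG G = p_infty.

Definition CIG_globally_concave (G : R -> R -> R) : Prop :=
  V_CIG G = p_infty.

Definition embedded_in (f : R -> R) (G : R -> R -> R) : Prop :=
  forall x, 0 <= x -> G 1 x = f x.

Definition is_inverse_onto_pos (h hinv : R -> R) : Prop :=
  (forall t, 0 < h t) /\
  (forall t, hinv (h t) = t) /\
  (forall x, 0 < x -> h (hinv x) = x).

Definition is_generating_function (G : R -> R -> R) (h : R -> R) : Prop :=
  exists hinv, is_inverse_onto_pos h hinv /\
    forall t x, 0 < x -> G t x = h (t + hinv x).

Definition is_CIG_velocity (G : R -> R -> R) (mu : R -> R) : Prop :=
  forall x, 0 <= x -> is_derive (fun t => G t x) 0 (mu x).

(* Main.v *)
Require Import Defs.
From Stdlib Require Import Reals Lra Lia ClassicalEpsilon.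
From Coquelicot Require Import Coquelicot.

(** A velocity mu on [0,oo) that vanishes at 0, is positive, increasing and
    concave on (0,oo), and whose travel time T (a primitive of 1/mu) maps
    (0,oo) onto R, generates the flow G^t(x) = h(t + T(x)) with h the inverse
    of T.  Its first two derivatives in x are
      G' = mu(G) / mu   and   G'' = mu(G) (mu'(G) - mu') / mu^2,
    and G^t(x) > x for t > 0; so mu increasing makes G^t - id increasing, and
    mu' decreasing makes G^t concave.  Smoothness passes from mu to h through
    h' = mu(h), and from h and T to the flow.  The whole iteration group is thus
    reduced to finding one velocity whose time 1 map exceeds f on (0,a), that
    is, one for which the travel time from x to f(x) is less than 1.

    The two demands on mu conflict near 0.  When f'(0+) is infinite, f(x) may
    tend to 0 as slowly as one likes, so mu has to be large for x and f(x) to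
    be close in time; but the travel time to 0 must stay infinite.  The choice
      mu(x) = sum_n c_n x / (e_n + x),   e_n = c_n / s_n,
    reconciles them.  The n-th term is about s_n x below the scale e_n and about
    c_n above it, so between the scales e_(n+1) and e_n the velocity is about
    max(s_n x, c_(n+1)), and crossing this interval takes about
    (1 / s_n) ln (c_n / c_(n+1)).  Taking c_(n+1) = c_n exp(- s_n / 16) makes
    every crossing last at least 1/64 and at most 1/4 ([crossing_time_ge],
    [crossing_time_le]).  The lower bound makes 0 infinitely far in time.  The
    slopes s_n remain free to grow, hence the scales e_n to shrink, as fast as
    desired: they are taken so that f(x) <= e_n for x <= e_(n+1).  With
    e_0 = f(a), the path from any x in (0,a) to f(x) meets at most two of the
    intervals and lasts at most 1/2 ([flow_outpaces]).

    Each term of mu is concave with negative second derivative and smooth on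
    (0,oo), and the series may be differentiated termwise to any order; hence
    mu'' < 0 everywhere and mu is of class C^n for every n. *)

(** * Functions of class C^n on an open set *)

(** This recursive form of C^n passes to products, inverses and composites by
    induction on n; iterated derivatives enter only in [class_on_Ck_on]. *)
Fixpoint class_on (n : nat) (D : R -> Prop) (f : R -> R) : Prop :=
  match n with
  | O => forall x, D x -> continuous f x
  | S m => exists f1, (forall x, D x -> is_derive f x (f1 x)) /\ class_on m D f1
  end.

Lemma is_derive_continuous (f : R -> R) x l : is_derive f x l -> continuous f x.
Proof. intros H; apply (ex_derive_continuous f x); now exists l. Qed.

Lemma class_on_continuous n D f x : class_on n D f -> D x -> continuous f x.
Proof.
destruct n as [|n]; simpl; [now auto|].
intros [f1 [H _]] Dx; exact (is_derive_continuous _ _ _ (H x Dx)).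
Qed.

Lemma class_on_S n D f : class_on (S n) D f -> class_on n D f.
Proof.
revert f; induction n as [|n IH]; intros f H.
- intros x Dx; exact (class_on_continuous 1 D f x H Dx).
- destruct H as [f1 [H1 H2]]; exists f1; split; [easy|now apply IH].
Qed.

Lemma locally_on (D P : R -> Prop) x :
  locally x D -> (forall y, D y -> P y) -> locally x P.
Proof. intros H DP; revert H; now apply filter_imp. Qed.

Lemma class_on_ext n D f g :
  open D -> (forall x, D x -> f x = g x) -> class_on n D f -> class_on n D g.
Proof.
intros oD efg; destruct n as [|n]; simpl.
- intros H x Dx; apply continuous_ext_loc with f; [|now auto].
  apply (locally_on _ _ x (oD x Dx)); exact efg.
- intros [f1 [H1 H2]]; exists f1; split; [|easy].
  intros x Dx; apply is_derive_ext_loc with f; [|now auto].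
  apply (locally_on _ _ x (oD x Dx)); exact efg.
Qed.

Lemma class_on_const n D c : class_on n D (fun _ => c).
Proof.
revert c; induction n as [|n IH]; intros c; simpl.
- intros x _; apply continuous_const.
- exists (fun _ => 0); split; [|apply IH].
  intros x _; exact (is_derive_const c x).
Qed.

Lemma class_on_id n D : class_on n D (fun x => x).
Proof.
destruct n as [|n]; simpl.
- intros x _; apply continuous_id.
- exists (fun _ => 1); split; [|apply class_on_const].
  intros x _; exact (is_derive_id x).
Qed.

Lemma class_on_plus n D f g :
  class_on n D f -> class_on n D g -> class_on n D (fun x => f x + g x).
Proof.
revert f g; induction n as [|n IH]; intros f g; simpl.
- intros Hf Hg x Dx; apply (continuous_plus f g x); auto.
- intros [f1 [Hf Hf1]] [g1 [Hg Hg1]]; exists (fun x => f1 x + g1 x).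
  split; [|now apply IH].
  intros x Dx; apply (is_derive_plus f g x); auto.
Qed.

Lemma is_derive_Rmult (f g : R -> R) x df dg :
  is_derive f x df -> is_derive g x dg ->
  is_derive (fun y => f y * g y) x (df * g x + f x * dg).
Proof.
intros Hf Hg; apply (is_derive_mult f g x df dg Hf Hg).
intros u v; apply Rmult_comm.
Qed.

Lemma class_on_mult n D f g :
  class_on n D f -> class_on n D g -> class_on n D (fun x => f x * g x).
Proof.
revert f g; induction n as [|n IH]; intros f g.
- intros Hf Hg x Dx; apply (continuous_mult f g x); [now apply Hf|now apply Hg].
- intros Cf Cg; generalize (class_on_S _ _ _ Cf) (class_on_S _ _ _ Cg).
  destruct Cf as [f1 [Hf Hf1]], Cg as [g1 [Hg Hg1]]; intros Cf Cg.
  exists (fun x => f1 x * g x + f x * g1 x); split.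
  + intros x Dx; apply is_derive_Rmult; auto.
  + apply class_on_plus; now apply IH.
Qed.

Lemma class_on_inv n D f :
  (forall x, D x -> f x <> 0) -> class_on n D f -> class_on n D (fun x => / f x).
Proof.
intros nz; induction n as [|n IH].
- intros Hf x Dx; apply (continuous_comp f Rinv x); [now apply Hf|].
  apply (is_derive_continuous _ _ (- 1 / (f x) ^ 2)).
  apply (is_derive_inv (fun y => y)); [exact (is_derive_id (f x))|now apply nz].
- intros Cf; generalize (IH (class_on_S _ _ _ Cf)); intros Ci.
  destruct Cf as [f1 [Hf Hf1]].
  exists (fun x => - 1 * (f1 x * (/ f x * / f x))); split.
  + intros x Dx; generalize (nz x Dx); intros nzx.
    replace (- 1 * _) with (- f1 x / f x ^ 2) by (field; easy).
    apply is_derive_inv; auto.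
  + apply class_on_mult; [apply class_on_const|].
    apply class_on_mult; [easy|now apply class_on_mult].
Qed.

Lemma is_derive_Rcomp (f g : R -> R) x df dg :
  is_derive f (g x) df -> is_derive g x dg ->
  is_derive (fun y => f (g y)) x (df * dg).
Proof.
intros Hf Hg; rewrite Rmult_comm; exact (is_derive_comp f g x df dg Hf Hg).
Qed.

Lemma class_on_comp n D E f g :
  (forall x, D x -> E (g x)) -> class_on n E f -> class_on n D g ->
  class_on n D (fun x => f (g x)).
Proof.
intros DE; revert f; induction n as [|n IH]; intros f.
- intros Hf Hg x Dx; apply continuous_comp; [now apply Hg|apply Hf; auto].
- intros [f1 [Hf Hf1]] Cg; generalize (class_on_S _ _ _ Cg).
  destruct Cg as [g1 [Hg Hg1]]; intros Cg.
  exists (fun x => f1 (g x) * g1 x); split.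
  + intros x Dx; apply is_derive_Rcomp; auto.
  + apply class_on_mult; [now apply IH|easy].
Qed.

(** Unfolds the nested existential into a single sequence of derivatives, which can
    be compared with [Derive_n] term by term. *)
Lemma class_on_derivatives n D f :
  class_on n D f ->
  exists F : nat -> R -> R,
    (forall x, D x -> F 0%nat x = f x) /\
    (forall j x, (j < n)%nat -> D x -> is_derive (F j) x (F (S j) x)) /\
    (forall x, D x -> continuous (F n) x).
Proof.
revert f; induction n as [|n IH]; intros f.
- intros Hf; exists (fun _ => f); repeat split; auto; intros; lia.
- intros [f1 [Hf Hf1]]; destruct (IH f1 Hf1) as [F [F0 [FS Fn]]].
  exists (fun j => match j with O => f | S i => F i end); split; [easy|].
  split; [|exact Fn].
  intros [|j] x jn Dx; [rewrite (F0 x Dx); now apply Hf|].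
  apply FS; [lia|easy].
Qed.

Lemma class_on_Ck_on n D f : open D -> class_on n D f -> Ck_on n D f.
Proof.
intros oD Cf; destruct (class_on_derivatives n D f Cf) as [F [F0 [FS Fn]]].
assert (DF : forall j, (j <= n)%nat -> forall x, D x -> Derive_n f j x = F j x).
{ induction j as [|j IH]; intros jn x Dx; simpl; [now rewrite F0|].
  rewrite (Derive_ext_loc _ (F j)).
  - apply is_derive_unique, FS; [lia|easy].
  - apply (locally_on _ _ x (oD x Dx)); intros y Dy; apply IH; [lia|easy]. }
intros x Dx; split.
- intros [|j] jn; simpl; [easy|].
  exists (F (S j) x); apply is_derive_ext_loc with (F j).
  + apply (locally_on _ _ x (oD x Dx)); intros y Dy; symmetry; apply DF; [lia|easy].
  + apply FS; [lia|easy].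
- apply continuous_ext_loc with (F n); [|now apply Fn].
  apply (locally_on _ _ x (oD x Dx)); intros y Dy; symmetry; now apply DF.
Qed.

Lemma open_pos_reals : open pos_reals.
Proof. exact (open_gt 0). Qed.

Lemma second_derivative (D : R -> Prop) f f1 f2 :
  open D ->
  (forall x, D x -> is_derive f x (f1 x)) ->
  (forall x, D x -> is_derive f1 x (f2 x)) ->
  twice_differentiable_on D f /\ forall x, D x -> Derive_n f 2 x = f2 x.
Proof.
intros oD H1 H2.
assert (L : forall x, D x -> locally x (fun y => f1 y = Derive f y)).
{ intros x Dx; apply (locally_on _ _ x (oD x Dx)); intros y Dy; symmetry.
  now apply is_derive_unique, H1. }
assert (H2' : forall x, D x -> is_derive (Derive f) x (f2 x)).
{ intros x Dx; apply is_derive_ext_loc with f1; auto. }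
split.
- intros x Dx; split; [exists (f1 x); now apply H1|exists (f2 x); now apply H2'].
- intros x Dx; simpl; now apply is_derive_unique, H2'.
Qed.

Lemma concave_on_of_derivatives D f f1 f2 :
  open D ->
  (forall x, D x -> is_derive f x (f1 x)) ->
  (forall x, D x -> is_derive f1 x (f2 x)) ->
  (forall x, D x -> f2 x <= 0) -> concave_on D f.
Proof.
intros oD H1 H2 neg; destruct (second_derivative D f f1 f2 oD H1 H2) as [T E].
split; [easy|]; intros x Dx; rewrite (E x Dx); auto.
Qed.

(** * Moduli of continuity *)

(** At 0 only a bound from above is asked for, since f >= 0 = f 0. *)
Lemma is_MOC_of_limit f :
  f 0 = 0 -> (forall x, 0 < x -> continuous f x) ->
  (forall x, 0 < x -> 0 <= f x) ->
  (forall eps, 0 < eps -> exists d, 0 < d /\ forall x, 0 < x < d -> f x < eps) ->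
  is_MOC f.
Proof.
intros f0 cf pf lf; split; [|split; [|easy]].
- intros x Hx; destruct (Req_dec x 0) as [->|nx].
  + intros P [eps HP]; destruct (lf eps (cond_pos eps)) as [d [dp Hd]].
    exists (mkposreal d dp); intros y By y0; apply HP.
    assert (By' : Rabs (y - 0) < d) by exact By.
    rewrite Rminus_0_r, (Rabs_right y) in By' by (red in y0; lra).
    change (Rabs (f y - f 0) < eps); rewrite f0, Rminus_0_r.
    destruct (Req_dec y 0) as [->|ny].
    * rewrite f0, Rabs_R0; apply cond_pos.
    * assert (yp : 0 < y) by (red in y0; lra).
      rewrite Rabs_right; [apply Hd; lra|apply Rle_ge; auto].
  + apply (filterlim_filter_le_1 _ (G := within nonneg_reals (locally x)) (F := locally x)); [|apply cf; red in Hx; lra].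
    apply filter_le_within.
- intros x Hx; destruct (Req_dec x 0) as [->|nx]; [lra|apply pf; lra].
Qed.

Lemma Rbar_lub_p_infty (E : Rbar -> Prop) : E p_infty -> Rbar_lub E = p_infty.
Proof.
intros H; apply Rbar_is_lub_unique; split.
- intros x _; now destruct x.
- intros b Hb; exact (Hb _ H).
Qed.

Lemma J_p_infty f :
  (forall x y, 0 <= x -> x < y -> f x - x < f y - y) -> J f = p_infty.
Proof. intros H; apply Rbar_lub_p_infty; split; [easy|]; intros x y x0 xy _; auto. Qed.

Lemma V_p_infty f : concave_on pos_reals f -> V f = p_infty.
Proof.
intros [H1 H2]; apply Rbar_lub_p_infty; split; [easy|]; split.
- intros x [x0 _]; now apply H1.
- intros x [x0 _]; now apply H2.
Qed.

Lemma Lub_Rbar_p_infty (E : R -> Prop) :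
  (forall x, 0 < x -> E x) -> Lub_Rbar E = p_infty.
Proof.
intros H; apply is_lub_Rbar_unique; split; [now intros x _|].
intros [b| |] Hb; [|easy|exact (Hb 1 (H 1 Rlt_0_1))].
assert (b0 : 0 < Rabs b + 1) by (generalize (Rabs_pos b); lra).
generalize (Hb _ (H _ b0)); simpl.
generalize (Rle_abs b); lra.
Qed.

(** A supremum equal to +oo need not be attained, but it exceeds y, so some
    interval of monotonicity contains both points. *)
Lemma strictly_increasing_of_J f x y :
  J f = p_infty -> 0 <= x -> x < y -> f x - x < f y - y.
Proof.
intros Jf x0 xy.
destruct (excluded_middle_informative (f x - x < f y - y)) as [|no]; [easy|exfalso].
assert (U : Rbar_is_lub (fun a => Rbar_le 0 a /\
   strictly_increasing_before (fun x => f x - x) a) (J f))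
  by exact (proj2_sig (Rbar_ex_lub _)).
rewrite Jf in U; destruct U as [_ U]; apply (U (Finite y)).
intros b [_ Hb]; destruct (Rbar_le_lt_dec b y) as [|yb]; [easy|].
elim no; exact (Hb x y x0 xy yb).
Qed.

(** Packages continuity at 0 as a function of eps, ready to drive the recursion
    that selects the scales. *)
Lemma MOC_small f : is_MOC f ->
  exists delta : R -> R, forall eps, 0 < eps ->
    0 < delta eps /\ forall x, 0 < x <= delta eps -> f x <= eps.
Proof.
intros [cf [pf f0]].
assert (S : forall eps, exists d, 0 < eps -> 0 < d /\ forall x, 0 < x <= d -> f x <= eps).
{ intros eps; destruct (Rlt_dec 0 eps) as [e0|]; [|now exists 0].
  assert (L : locally (f 0) (fun y => y <= eps)).
  { exists (mkposreal eps e0); intros y Hy; change (Rabs (y - f 0) < eps) in Hy.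
    rewrite f0, Rminus_0_r in Hy; generalize (Rle_abs y); lra. }
  destruct (cf 0 (Rle_refl 0) _ L) as [d Hd].
  exists (d / 2); intros _; split; [generalize (cond_pos d); lra|].
  intros x Hx; apply Hd; [|red; lra].
  change (Rabs (x - 0) < d); rewrite Rminus_0_r, Rabs_right; lra. }
exists (fun eps => proj1_sig (constructive_indefinite_description _ (S eps))).
intros eps; exact (proj2_sig (constructive_indefinite_description _ (S eps))).
Qed.

Lemma globally_acceptable_lt f x y :
  globally_acceptable f -> 0 <= x -> x < y -> f x < f y.
Proof.
intros [_ Jf] x0 xy; generalize (strictly_increasing_of_J f x y Jf x0 xy); lra.
Qed.

(** * The flow of a concave velocity *)

(** [velocity_limit] is continuity at 0 from the right. *)
Record velocity (mu mu1 mu2 : R -> R) : Prop := {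
  velocity_0 : mu 0 = 0;
  velocity_pos : forall x, 0 < x -> 0 < mu x;
  velocity_derive : forall x, 0 < x -> is_derive mu x (mu1 x);
  velocity_derive_2 : forall x, 0 < x -> is_derive mu1 x (mu2 x);
  velocity_increasing : forall x, 0 < x -> 0 < mu1 x;
  velocity_concave : forall x, 0 < x -> mu2 x < 0;
  velocity_class : forall n, class_on n pos_reals mu;
  velocity_limit : forall eps, 0 < eps ->
    exists d, 0 < d /\ forall x, 0 < x < d -> mu x < eps
}.

(** T measures travel time along the flow and h is the orbit it parametrizes, so
    in the coordinate T the flow is translation. *)
Record time_chart (mu T h : R -> R) : Prop := {
  chart_derive : forall x, 0 < x -> is_derive T x (/ mu x);
  chart_pos : forall t, 0 < h t;
  chart_time : forall t, T (h t) = t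
}.

Lemma increment_le (F G F1 G1 : R -> R) x y :
  x <= y ->
  (forall z, x <= z <= y -> is_derive F z (F1 z)) ->
  (forall z, x <= z <= y -> is_derive G z (G1 z)) ->
  (forall z, x <= z <= y -> F1 z <= G1 z) -> F y - F x <= G y - G x.
Proof.
intros xy HF HG le; destruct (Req_dec x y) as [->|ne]; [lra|].
destruct (MVT_cor2 (fun z => G z - F z) (fun z => G1 z - F1 z) x y)
  as [c [E cb]]; [lra| |].
- intros c Hc; apply is_derive_Reals, (is_derive_minus G F c); auto.
- assert (0 <= (G1 c - F1 c) * (y - x)); [|lra].
  apply Rmult_le_pos; [generalize (le c); lra|lra].
Qed.

Lemma increasing_of_derive (F F1 : R -> R) x y :
  0 < x -> x < y ->
  (forall z, 0 < z -> is_derive F z (F1 z)) ->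
  (forall z, 0 < z -> 0 < F1 z) -> F x < F y.
Proof.
intros x0 xy HF pos.
destruct (MVT_cor2 F F1 x y xy) as [c [E cb]].
- intros c Hc; apply is_derive_Reals, HF; lra.
- assert (0 < F1 c * (y - x)); [|lra].
  apply Rmult_lt_0_compat; [apply pos|]; lra.
Qed.

Lemma velocity_lt mu mu1 mu2 x y :
  velocity mu mu1 mu2 -> 0 < x -> x < y -> mu x < mu y.
Proof.
intros H x0 xy; apply (increasing_of_derive mu mu1); auto; apply H.
Qed.

Lemma velocity_derive_le mu mu1 mu2 x y :
  velocity mu mu1 mu2 -> 0 < x -> x <= y -> mu1 y <= mu1 x.
Proof.
intros H x0 [xy| ->]; [|lra].
cut (- mu1 x < - mu1 y); [lra|].
apply (increasing_of_derive (fun x => - mu1 x) (fun x => - mu2 x)); auto.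
- intros z z0; apply (is_derive_opp mu1 z); now apply H.
- intros z z0; generalize (velocity_concave _ _ _ H z z0); lra.
Qed.

(** Substituting x = exp u turns T into a continuous function on the whole line,
    to which the intermediate value theorem applies; a choice of preimages is
    then the inverse. *)
Lemma time_chart_exists mu (T : R -> R) :
  (forall x, 0 < x -> is_derive T x (/ mu x)) ->
  (forall M, exists x, 0 < x /\ T x <= M) ->
  (forall M, exists x, 0 < x /\ M <= T x) ->
  exists h, time_chart mu T h.
Proof.
intros dT lo hi.
assert (S : forall t, exists x, 0 < x /\ T x = t).
{ intros t; destruct (lo t) as [x [x0 Hx]], (hi t) as [y [y0 Hy]].
  destruct (IVT_gen (fun u => T (exp u)) (ln x) (ln y) t) as [u [_ Hu]].
  - intros u; apply continuity_pt_filterlim.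
    apply (continuous_comp exp T u).
    + exact (is_derive_continuous _ _ _ (is_derive_exp u)).
    + exact (is_derive_continuous _ _ _ (dT _ (exp_pos u))).
  - rewrite !exp_ln by easy.
    rewrite Rmin_left, Rmax_right by lra; lra.
  - exists (exp u); split; [apply exp_pos|easy]. }
exists (fun t => proj1_sig (constructive_indefinite_description _ (S t))).
split; [easy| |]; intros t;
  now destruct (proj2_sig (constructive_indefinite_description _ (S t))).
Qed.

Lemma chart_lt mu mu1 mu2 T h x y :
  velocity mu mu1 mu2 -> time_chart mu T h -> 0 < x -> x < y -> T x < T y.
Proof.
intros Hmu HT x0 xy; apply (increasing_of_derive T (fun x => / mu x)); auto.
- intros z; now apply HT.
- intros z z0; now apply Rinv_0_lt_compat, Hmu.
Qed.

Lemma chart_lt_inv mu mu1 mu2 T h x y :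
  velocity mu mu1 mu2 -> time_chart mu T h -> 0 < x -> 0 < y ->
  T x < T y -> x < y.
Proof.
intros Hmu HT x0 y0 lt; destruct (Rle_or_lt y x) as [[yx| ->]|]; [exfalso|lra|easy].
generalize (chart_lt _ _ _ _ _ _ _ Hmu HT y0 yx); lra.
Qed.

Lemma chart_inv mu mu1 mu2 T h x :
  velocity mu mu1 mu2 -> time_chart mu T h -> 0 < x -> h (T x) = x.
Proof.
intros Hmu HT x0; generalize (chart_time _ _ _ HT (T x)) (chart_pos _ _ _ HT (T x)).
intros E p; destruct (Rtotal_order (h (T x)) x) as [lt|[|lt]]; [exfalso|easy|exfalso].
- generalize (chart_lt _ _ _ _ _ _ _ Hmu HT p lt); lra.
- generalize (chart_lt _ _ _ _ _ _ _ Hmu HT x0 lt); lra.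
Qed.

Lemma chart_h_lt mu mu1 mu2 T h s t :
  velocity mu mu1 mu2 -> time_chart mu T h -> s < t -> h s < h t.
Proof.
intros Hmu HT st; apply (chart_lt_inv _ _ _ _ _ _ _ Hmu HT); try apply HT.
now rewrite !(chart_time _ _ _ HT).
Qed.

(** Monotonicity suffices: T maps a small interval around h t onto an interval
    around t. *)
Lemma chart_continuous mu mu1 mu2 T h t eps :
  velocity mu mu1 mu2 -> time_chart mu T h -> 0 < eps ->
  exists d, 0 < d /\ forall s, Rabs (s - t) < d -> Rabs (h s - h t) < eps.
Proof.
intros Hmu HT e0; set (x := h t).
assert (x0 : 0 < x) by apply HT.
set (e := Rmin (eps / 2) (x / 2)).
assert (ee : 0 < e /\ e < eps /\ e < x).
{ unfold e; split; [apply Rmin_glb_lt; lra|].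
  generalize (Rmin_l (eps / 2) (x / 2)) (Rmin_r (eps / 2) (x / 2)); lra. }
generalize (chart_lt _ _ _ _ _ (x - e) x Hmu HT ltac:(lra) ltac:(lra)).
generalize (chart_lt _ _ _ _ _ x (x + e) Hmu HT ltac:(lra) ltac:(lra)).
replace (T x) with t by (symmetry; apply HT); intros up low.
exists (Rmin (T (x + e) - t) (t - T (x - e))); split; [apply Rmin_glb_lt; lra|].
intros s Hs; assert (b : T (x - e) < s < T (x + e)).
{ apply Rabs_def2 in Hs.
  generalize (Rmin_l (T (x + e) - t) (t - T (x - e)))
             (Rmin_r (T (x + e) - t) (t - T (x - e))); lra. }
rewrite <- (chart_time _ _ _ HT s) in b.
apply Rabs_def1.
- cut (h s < x + e); [lra|].
  apply (chart_lt_inv _ _ _ _ _ _ _ Hmu HT); [apply HT|lra|lra].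
- cut (x - e < h s); [lra|].
  apply (chart_lt_inv _ _ _ _ _ _ _ Hmu HT); [lra|apply HT|lra].
Qed.

(** By the mean value theorem for T, the difference quotient of h is a value of mu
    at a point between h t and h (t + u), and these points tend to h t. *)
Lemma chart_h_derive mu mu1 mu2 T h t :
  velocity mu mu1 mu2 -> time_chart mu T h -> is_derive h t (mu (h t)).
Proof.
intros Hmu HT; apply is_derive_Reals; intros eps e0.
assert (x0 : 0 < h t) by apply HT.
assert (c : continuity_pt mu (h t)).
{ apply continuity_pt_filterlim.
  exact (is_derive_continuous _ _ _ (velocity_derive _ _ _ Hmu _ x0)). }
destruct (c eps e0) as [d1 [d1p Hd1]].
destruct (chart_continuous _ _ _ _ _ t d1 Hmu HT d1p) as [d [d0 Hd]].
exists (mkposreal d d0); simpl; intros u u0 ud.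
assert (yd : Rabs (h (t + u) - h t) < d1) by (apply Hd; now replace (t + u - t) with u by ring).
set (y := h (t + u)) in *; assert (y0 : 0 < y) by apply HT.
destruct (MVT_gen T (h t) y (fun z => / mu z)) as [c' [cb E]].
- intros z Hz; apply HT; generalize (Rmin_glb_lt _ _ _ x0 y0); lra.
- intros z Hz; apply continuity_pt_filterlim.
  apply (is_derive_continuous T z (/ mu z)), HT.
  generalize (Rmin_glb_lt _ _ _ x0 y0); lra.
- assert (c0 : 0 < c') by (generalize (Rmin_glb_lt _ _ _ x0 y0); lra).
  assert (m0 := velocity_pos _ _ _ Hmu c' c0).
  unfold y in E at 1; rewrite !(chart_time _ _ _ HT) in E.
  replace ((y - h t) / u) with (mu c').
  + destruct (Req_dec c' (h t)) as [->|ne]; [now rewrite Rminus_diag_eq, Rabs_R0|].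
    apply Hd1; split; [split; [easy|auto]|].
    apply Rle_lt_trans with (2 := yd); unfold dist; simpl; unfold R_dist.
    revert cb; unfold Rmin, Rmax; destruct (Rle_dec (h t) y); intros cb;
      unfold Rabs; destruct (Rcase_abs (c' - h t)), (Rcase_abs (y - h t)); lra.
  + assert (u = / mu c' * (y - h t)) by lra.
    replace (y - h t) with (mu c' * u); [field; easy|].
    rewrite H; field; lra.
Qed.

(** The equation h' = mu(h) gains one derivative at each step. *)
Lemma chart_h_class mu mu1 mu2 T h n :
  velocity mu mu1 mu2 -> time_chart mu T h -> class_on n (fun _ => True) h.
Proof.
intros Hmu HT; induction n as [|n IH].
- intros t _; exact (is_derive_continuous _ _ _ (chart_h_derive _ _ _ _ _ t Hmu HT)).
- exists (fun t => mu (h t)); split.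
  + intros t _; exact (chart_h_derive _ _ _ _ _ t Hmu HT).
  + apply class_on_comp with pos_reals; [|apply Hmu|easy].
    intros t _; apply HT.
Qed.

Lemma chart_T_class mu mu1 mu2 T h n :
  velocity mu mu1 mu2 -> time_chart mu T h -> class_on n pos_reals T.
Proof.
intros Hmu HT; apply class_on_S; exists (fun x => / mu x); split; [apply HT|].
apply class_on_inv; [|apply Hmu].
intros x x0; generalize (velocity_pos _ _ _ Hmu x x0); lra.
Qed.

(** The value 0 for x <= 0 makes 0 a fixed point. *)
Definition flow (T h : R -> R) (t x : R) : R :=
  if Rlt_dec 0 x then h (t + T x) else 0.

Lemma flow_pos_eq T h t x : 0 < x -> flow T h t x = h (t + T x).
Proof. now unfold flow; destruct (Rlt_dec 0 x). Qed.

Lemma flow_0 T h t : flow T h t 0 = 0.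
Proof. unfold flow; destruct (Rlt_dec 0 0); [lra|easy]. Qed.

Lemma flow_gt mu mu1 mu2 T h t x :
  velocity mu mu1 mu2 -> time_chart mu T h -> 0 < t -> 0 < x -> x < flow T h t x.
Proof.
intros Hmu HT t0 x0; rewrite flow_pos_eq by easy.
rewrite <- (chart_inv _ _ _ _ _ x Hmu HT x0) at 1.
apply (chart_h_lt _ _ _ _ _ _ _ Hmu HT); lra.
Qed.

Lemma flow_derive mu mu1 mu2 T h t x :
  velocity mu mu1 mu2 -> time_chart mu T h -> 0 < x ->
  is_derive (flow T h t) x (mu (flow T h t x) / mu x).
Proof.
intros Hmu HT x0; apply is_derive_ext_loc with (fun y => h (t + T y)).
- apply (locally_on _ _ x (open_pos_reals x x0)); intros y y0.
  symmetry; now apply flow_pos_eq.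
- rewrite flow_pos_eq by easy.
  apply (is_derive_Rcomp h (fun y => t + T y)).
  + exact (chart_h_derive _ _ _ _ _ _ Hmu HT).
  + rewrite <- (Rplus_0_l (/ mu x)).
    apply (is_derive_plus (fun _ => t) T x); [exact (is_derive_const t x)|now apply HT].
Qed.

Lemma flow_derive_2 mu mu1 mu2 T h t x :
  velocity mu mu1 mu2 -> time_chart mu T h -> 0 < x ->
  is_derive (fun y => mu (flow T h t y) / mu y) x
    (mu (flow T h t x) * (mu1 (flow T h t x) - mu1 x) / mu x ^ 2).
Proof.
intros Hmu HT x0; assert (m0 := velocity_pos _ _ _ Hmu x x0).
replace (_ / _) with
  ((mu1 (flow T h t x) * (mu (flow T h t x) / mu x) * mu x
    - mu (flow T h t x) * mu1 x) / mu x ^ 2) by (field; lra).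
apply (is_derive_div (fun y => mu (flow T h t y)) mu x); [|now apply Hmu|lra].
apply (is_derive_Rcomp mu (flow T h t)).
- apply Hmu; rewrite flow_pos_eq by easy; apply HT.
- now apply (flow_derive _ mu1 mu2).
Qed.

Lemma flow_class mu mu1 mu2 T h t n :
  velocity mu mu1 mu2 -> time_chart mu T h -> class_on n pos_reals (flow T h t).
Proof.
intros Hmu HT; apply class_on_ext with (fun x => h (t + T x)); [apply open_pos_reals| |].
- intros x x0; symmetry; now apply flow_pos_eq.
- apply class_on_comp with (fun _ => True); [easy| |].
  + exact (chart_h_class _ _ _ _ _ n Hmu HT).
  + apply class_on_plus; [apply class_on_const|].
    exact (chart_T_class _ _ _ _ _ n Hmu HT).
Qed.

Lemma flow_MOC mu mu1 mu2 T h t :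
  velocity mu mu1 mu2 -> time_chart mu T h -> is_MOC (flow T h t).
Proof.
intros Hmu HT; apply is_MOC_of_limit.
- apply flow_0.
- intros x x0; exact (class_on_continuous 0 _ _ _ (flow_class _ _ _ _ _ t 0 Hmu HT) x0).
- intros x x0; rewrite flow_pos_eq by easy; apply Rlt_le, HT.
- intros eps e0; exists (h (T eps - t)); split; [apply HT|].
  intros x [x0 xd]; rewrite flow_pos_eq by easy.
  rewrite <- (chart_inv _ _ _ _ _ eps Hmu HT e0).
  apply (chart_h_lt _ _ _ _ _ _ _ Hmu HT).
  generalize (chart_lt _ _ _ _ _ _ _ Hmu HT x0 xd).
  rewrite (chart_time _ _ _ HT); lra.
Qed.

Lemma flow_Ck_MOC mu mu1 mu2 T h t n :
  velocity mu mu1 mu2 -> time_chart mu T h -> is_Ck_MOC n (flow T h t).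
Proof.
intros Hmu HT; assert (M := flow_MOC _ _ _ _ _ t Hmu HT).
split; [easy|split; [apply M|]].
apply class_on_Ck_on; [apply open_pos_reals|].
exact (flow_class _ _ _ _ _ t n Hmu HT).
Qed.

Lemma flow_CIG mu mu1 mu2 T h :
  velocity mu mu1 mu2 -> time_chart mu T h -> is_CIG (flow T h).
Proof.
intros Hmu HT; split.
- intros t; exact (flow_MOC _ _ _ _ _ t Hmu HT).
- intros t x; exact (flow_gt _ _ _ _ _ t x Hmu HT).
- intros s t x [x0| <-]; [|now rewrite !flow_0].
  rewrite (flow_pos_eq _ _ t), (flow_pos_eq _ _ (s + t)), flow_pos_eq by (auto; apply HT).
  rewrite (chart_time _ _ _ HT); f_equal; ring.
- intros x [x0| <-]; [|now rewrite flow_0].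
  rewrite flow_pos_eq, Rplus_0_l by easy; exact (chart_inv _ _ _ _ _ x Hmu HT x0).
- intros t x [x0| <-].
  + apply continuous_ext with (fun s => h (s + T x)).
    { intros s; symmetry; now apply flow_pos_eq. }
    apply (continuous_comp (fun s => s + T x) h t).
    * apply (continuous_plus (fun s => s) (fun _ => T x) t);
        [apply continuous_id|apply continuous_const].
    * exact (is_derive_continuous _ _ _ (chart_h_derive _ _ _ _ _ _ Hmu HT)).
  + apply continuous_ext with (fun _ => 0); [intros s; now rewrite flow_0|].
    apply continuous_const.
Qed.

(** The flow moves points up and mu' is decreasing, so mu'(G x) <= mu'(x). *)
Lemma flow_concave mu mu1 mu2 T h t :
  velocity mu mu1 mu2 -> time_chart mu T h -> 0 < t -> globally_concave (flow T h t).
Proof.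
intros Hmu HT t0.
apply (concave_on_of_derivatives _ _ _ _ open_pos_reals
  (fun x x0 => flow_derive _ _ _ _ _ t x Hmu HT x0)
  (fun x x0 => flow_derive_2 _ _ _ _ _ t x Hmu HT x0)).
intros x x0; assert (gt := flow_gt _ _ _ _ _ t x Hmu HT t0 x0); red in x0.
set (y := flow T h t x) in *.
assert (m0 := velocity_pos _ _ _ Hmu x x0).
assert (my := velocity_pos _ _ _ Hmu y ltac:(lra)).
assert (d := velocity_derive_le _ _ _ x y Hmu x0 ltac:(lra)).
assert (p : 0 < / mu x ^ 2) by (apply Rinv_0_lt_compat, pow_lt; lra).
cut (0 <= mu y * (mu1 x - mu1 y) * / mu x ^ 2); [unfold Rdiv; lra|].
apply Rmult_le_pos; [apply Rmult_le_pos|]; lra.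
Qed.

(** The derivative mu(G x) / mu(x) of the flow exceeds 1 because G x > x and mu is
    increasing.  At x = 0, where there may be no derivative, expansiveness
    replaces it. *)
Lemma flow_acceptable mu mu1 mu2 T h t :
  velocity mu mu1 mu2 -> time_chart mu T h -> 0 < t -> globally_acceptable (flow T h t).
Proof.
intros Hmu HT t0; split; [split|].
- exact (flow_Ck_MOC _ _ _ _ _ t 1 Hmu HT).
- intros x; exact (flow_gt _ _ _ _ _ t x Hmu HT t0).
- apply J_p_infty; intros x y [x0| <-] xy.
  + apply (increasing_of_derive (fun x => flow T h t x - x)
      (fun x => mu (flow T h t x) / mu x - 1)); auto.
    * intros z z0; apply (is_derive_minus (flow T h t) (fun x => x) z).
      -- exact (flow_derive _ _ _ _ _ t z Hmu HT z0).
      -- exact (is_derive_id z).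
    * intros z z0; assert (gt := flow_gt _ _ _ _ _ t z Hmu HT t0 z0).
      assert (m0 := velocity_pos _ _ _ Hmu z z0).
      assert (lt := velocity_lt _ _ _ _ _ Hmu z0 gt).
      assert (p := Rdiv_lt_0_compat (mu (flow T h t z) - mu z) (mu z) ltac:(lra) m0).
      replace (_ - 1) with ((mu (flow T h t z) - mu z) / mu z); [easy|field; lra].
  + rewrite flow_0; generalize (flow_gt _ _ _ _ _ t y Hmu HT t0 xy); lra.
Qed.

Lemma flow_globally_concave mu mu1 mu2 T h :
  velocity mu mu1 mu2 -> time_chart mu T h -> CIG_globally_concave (flow T h).
Proof.
intros Hmu HT; apply Lub_Rbar_p_infty; intros a a0; split; [easy|].
intros t t0; rewrite V_p_infty; [easy|].
exact (flow_concave _ _ _ _ _ t Hmu HT t0).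
Qed.

Lemma flow_globally_acceptable mu mu1 mu2 T h :
  velocity mu mu1 mu2 -> time_chart mu T h -> CIG_globally_acceptable (flow T h).
Proof.
intros Hmu HT; apply Lub_Rbar_p_infty; intros a a0; split; [easy|].
intros t t0; destruct (flow_acceptable _ _ _ _ _ t Hmu HT t0) as [E Jt].
split; [split; [easy|]|]; now rewrite Jt.
Qed.

Lemma flow_velocity mu mu1 mu2 T h :
  velocity mu mu1 mu2 -> time_chart mu T h -> is_CIG_velocity (flow T h) mu.
Proof.
intros Hmu HT x [x0| <-].
- apply is_derive_ext with (fun t => h (t + T x)).
  { intros t; symmetry; now apply flow_pos_eq. }
  replace (mu x) with (mu x * 1) by ring.
  apply (is_derive_Rcomp h (fun t => t + T x)).
  + replace (mu x) with (mu (h (0 + T x))).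
    2: now rewrite Rplus_0_l, (chart_inv _ _ _ _ _ x Hmu HT x0).
    exact (chart_h_derive _ _ _ _ _ _ Hmu HT).
  + rewrite <- (Rplus_0_r 1).
    apply (is_derive_plus (fun t => t) (fun _ => T x) 0);
      [exact (is_derive_id 0)|exact (is_derive_const (T x) 0)].
- rewrite (velocity_0 _ _ _ Hmu); apply is_derive_ext with (fun _ => 0).
  { intros t; now rewrite flow_0. }
  exact (is_derive_const 0 0).
Qed.

Lemma flow_generating mu mu1 mu2 T h :
  velocity mu mu1 mu2 -> time_chart mu T h -> is_generating_function (flow T h) h.
Proof.
intros Hmu HT; exists T; split; [split; [apply HT|split; [apply HT|]]|].
- intros x x0; exact (chart_inv _ _ _ _ _ x Hmu HT x0).
- intros t x x0; now apply flow_pos_eq.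
Qed.

(** A generating function is determined up to a translation of time: evaluating
    the flow at the point 1 shows that g is a translate of h. *)
Lemma generating_function_class mu mu1 mu2 T h g n :
  velocity mu mu1 mu2 -> time_chart mu T h -> is_generating_function (flow T h) g ->
  Ck_on n (fun _ => True) g.
Proof.
intros Hmu HT [ginv [_ Hg]]; apply class_on_Ck_on; [apply open_true|].
assert (E : forall s : R, h (s + (T 1 - ginv 1)) = g s).
{ intros s.
  replace (s + (T 1 - ginv 1)) with (s - ginv 1 + T 1) by ring.
  rewrite <- (flow_pos_eq T h _ 1 Rlt_0_1), Hg by lra; f_equal; ring. }
apply class_on_ext with (fun s => h (s + (T 1 - ginv 1))); [apply open_true| |].
- intros s _; apply E.
- apply class_on_comp with (fun _ => True); [easy| |].
  + exact (chart_h_class _ _ _ _ _ n Hmu HT).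
  + apply class_on_plus; [apply class_on_id|apply class_on_const].
Qed.

(** * Series of simple poles *)

(** Termwise differentiation of a series is easiest with quadratic remainders,
    as these can be summed without discussing uniform convergence. *)
Lemma is_derive_of_quadratic (f : R -> R) x l r C :
  0 < r ->
  (forall y, Rabs (y - x) < r -> Rabs (f y - f x - (y - x) * l) <= C * (y - x) ^ 2) ->
  is_derive f x l.
Proof.
intros r0 H; apply is_derive_Reals; intros eps e0.
set (K := Rabs C + 1).
assert (K0 : 0 < K) by (unfold K; generalize (Rabs_pos C); lra).
assert (d0 : 0 < Rmin r (eps / K)) by (apply Rmin_glb_lt; [|apply Rdiv_lt_0_compat]; lra).
exists (mkposreal _ d0); simpl; intros u u0 ud.
assert (ur : Rabs u < r) by (generalize (Rmin_l r (eps / K)); lra).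
assert (ue : Rabs u < eps / K) by (generalize (Rmin_r r (eps / K)); lra).
assert (Hu := H (x + u)); replace (x + u - x) with u in Hu by ring; specialize (Hu ur).
assert (pu := Rabs_pos_lt u u0).
replace (_ - l) with ((f (x + u) - f x - u * l) * / u) by (field; easy).
rewrite Rabs_mult, Rabs_inv.
apply (Rmult_lt_reg_r (Rabs u)); [easy|].
replace (_ * _ * _) with (Rabs (f (x + u) - f x - u * l)) by (field; lra).
apply Rle_lt_trans with (1 := Hu).
rewrite <- (Rsqr_pow2 u), (Rsqr_abs u); unfold Rsqr.
assert (CK : C <= K) by (unfold K; generalize (Rle_abs C); lra).
apply Rle_lt_trans with (K * (Rabs u * Rabs u)).
- apply Rmult_le_compat_r; [|easy]; apply Rmult_le_pos; lra.
- rewrite <- Rmult_assoc; apply Rmult_lt_compat_r; [easy|].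
  apply (Rmult_lt_reg_r (/ K)); [now apply Rinv_0_lt_compat|].
  replace (K * Rabs u * / K) with (Rabs u) by (field; lra); exact ue.
Qed.

(** The relation between p and q is the one satisfied by p = 1/(e+x) and
    q = 1/(e+y) with d = y - x; stated this way the bound does not depend on e. *)
Lemma pow_diff_bound p q d B m :
  0 <= p <= B -> 0 <= q <= B -> q - p = - d * p * q ->
  Rabs (q ^ m - p ^ m) <= INR m * Rabs d * B ^ S m.
Proof.
intros Hp Hq E; induction m as [|m IH].
- simpl; rewrite Rminus_diag_eq, Rabs_R0 by easy; lra.
- replace (q ^ S m - p ^ S m) with (q * (q ^ m - p ^ m) + (q - p) * p ^ m) by (simpl; ring).
  rewrite E, S_INR.
  assert (P : 0 <= p ^ m <= B ^ m) by (split; [apply pow_le|apply pow_incr]; lra).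
  eapply Rle_trans; [apply Rabs_triang|].
  rewrite !Rabs_mult, Rabs_Ropp, (Rabs_right p), (Rabs_right q), (Rabs_right (p ^ m)) by lra.
  replace ((INR m + 1) * Rabs d * B ^ S (S m)) with
    (B * (INR m * Rabs d * B ^ S m) + Rabs d * B * B * B ^ m) by (simpl; ring).
  assert (d0 := Rabs_pos d).
  apply Rplus_le_compat.
  + apply Rmult_le_compat; [lra|apply Rabs_pos|lra|easy].
  + apply Rmult_le_compat; [|lra| |lra].
    * apply Rmult_le_pos; [apply Rmult_le_pos|]; lra.
    * apply Rmult_le_compat; [apply Rmult_le_pos; lra|lra| |lra].
      apply Rmult_le_compat_l; lra.
Qed.

(** First order Taylor expansion of 1/(e+x)^m, with a remainder uniform in e.
    The coefficients C_m of the remainder satisfy C_(m+1) = C_m + m + 1, which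
    m^2 dominates. *)
Lemma pow_taylor_bound p q d B m :
  0 <= p <= B -> 0 <= q <= B -> q - p = - d * p * q ->
  Rabs (q ^ m - p ^ m + INR m * d * p ^ S m) <= INR m ^ 2 * d ^ 2 * B ^ (m + 2).
Proof.
intros Hp Hq E; induction m as [|m IH].
- simpl; rewrite !Rmult_0_l, Rplus_0_r, Rminus_diag_eq, Rabs_R0 by easy; lra.
(* Peeling off one factor p leaves an error of the kind bounded in
   [pow_diff_bound]. *)
- replace (q ^ S m - p ^ S m + INR (S m) * d * p ^ S (S m)) with
    (p * (q ^ m - p ^ m + INR m * d * p ^ S m) + - (d * p * (q ^ S m - p ^ S m))).
  2: { replace (q ^ S m) with (q ^ m * p + q ^ m * (q - p)) at 2 by (simpl; ring).
       rewrite S_INR, E; simpl; ring. }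
  eapply Rle_trans; [apply Rabs_triang|].
  assert (m0 := pos_INR m).
  assert (B2 : 0 <= d ^ 2 * B ^ (m + 3)) by
    (apply Rmult_le_pos; [apply pow2_ge_0|apply pow_le; lra]).
  apply Rle_trans with
    (B * (INR m ^ 2 * d ^ 2 * B ^ (m + 2)) + Rabs d * B * (INR (S m) * Rabs d * B ^ S (S m))).
  + rewrite Rabs_Ropp, !Rabs_mult, (Rabs_right p) by lra.
    apply Rplus_le_compat.
    * apply Rmult_le_compat; [lra|apply Rabs_pos|lra|easy].
    * apply Rmult_le_compat; [apply Rmult_le_pos; [apply Rabs_pos|lra]|apply Rabs_pos| |].
      -- apply Rmult_le_compat_l; [apply Rabs_pos|lra].
      -- now apply pow_diff_bound.
  + replace (S m + 2)%nat with (S (m + 2)) by lia.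
    replace (m + 3)%nat with (S (m + 2)) in B2 by lia.
    replace (S (S m)) with (m + 2)%nat by lia.
    replace (Rabs d * B * (INR (S m) * Rabs d * B ^ (m + 2))) with
      (INR (S m) * (d ^ 2 * B ^ S (m + 2))).
    2: { rewrite <- (Rsqr_pow2 d), (Rsqr_abs d); unfold Rsqr; simpl; ring. }
    replace (B * (INR m ^ 2 * d ^ 2 * B ^ (m + 2))) with
      (INR m ^ 2 * (d ^ 2 * B ^ S (m + 2))) by (simpl; ring).
    rewrite (Rmult_assoc (INR (S m) ^ 2)), <- Rmult_plus_distr_r.
    apply Rmult_le_compat_r; [easy|]; rewrite S_INR; nra.
Qed.

(** The derivative of a pole series of order m is, up to a factor, one of order
    m + 1, so this family contains all derivatives of its members. *)
Definition pole_series (a e : nat -> R) (m : nat) (x : R) : R :=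
  Series (fun n => a n * (/ (e n + x)) ^ m).

Lemma pole_bound e x z : 0 <= e -> 0 < z -> z <= x -> 0 < / (e + x) <= / z.
Proof.
intros e0 z0 zx; split; [apply Rinv_0_lt_compat|apply Rinv_le_contravar]; lra.
Qed.

Lemma pole_series_ex a e m x :
  ex_series a -> (forall n, 0 <= a n) -> (forall n, 0 <= e n) -> 0 < x ->
  ex_series (fun n => a n * (/ (e n + x)) ^ m).
Proof.
intros sa a0 e0 x0.
apply (@ex_series_le R_AbsRing R_CompleteNormedModule) with (fun n => a n * (/ x) ^ m).
- intros n; destruct (pole_bound (e n) x x (e0 n) x0 (Rle_refl x)) as [p1 p2].
  change (Rabs (a n * (/ (e n + x)) ^ m) <= a n * (/ x) ^ m).
  rewrite Rabs_right.
  + apply Rmult_le_compat_l; [easy|]; apply pow_incr; lra.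
  + apply Rle_ge, Rmult_le_pos; [easy|]; apply pow_le; lra.
- now apply ex_series_scal_r.
Qed.

Lemma pole_series_derive a e m x :
  ex_series a -> (forall n, 0 <= a n) -> (forall n, 0 <= e n) -> 0 < x ->
  is_derive (pole_series a e m) x (- INR m * pole_series a e (S m) x).
Proof.
intros sa a0 e0 x0; set (B := / (x / 2)).
apply (is_derive_of_quadratic _ _ _ (x / 2) (Series a * (INR m ^ 2 * B ^ (m + 2)))); [lra|].
(* Staying within x / 2 of x keeps every pole factor at most B = 2 / x. *)
intros y yx.
assert (y2 : x / 2 <= y) by (apply Rabs_def2 in yx; lra).
assert (T : forall n, Rabs (a n * ((/ (e n + y)) ^ m - (/ (e n + x)) ^ m
     + INR m * (y - x) * (/ (e n + x)) ^ S m))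
   <= a n * (INR m ^ 2 * (y - x) ^ 2 * B ^ (m + 2))).
{ intros n; rewrite Rabs_mult, (Rabs_right (a n)) by (apply Rle_ge, a0).
  apply Rmult_le_compat_l; [easy|].
  destruct (pole_bound (e n) x (x / 2)) as [p1 p2]; [easy|lra|lra|].
  destruct (pole_bound (e n) y (x / 2)) as [q1 q2]; [easy|lra|lra|].
  apply pow_taylor_bound; [fold B in p2; lra|fold B in q2; lra|].
  assert (0 <= e n) by easy; field; lra. }
assert (sB : ex_series (fun n => a n * (INR m ^ 2 * (y - x) ^ 2 * B ^ (m + 2))))
  by now apply ex_series_scal_r.
assert (Ex := pole_series_ex a e m x sa a0 e0 x0).
assert (Ey := pole_series_ex a e m y sa a0 e0 ltac:(lra)).
assert (Ex1 := pole_series_ex a e (S m) x sa a0 e0 x0).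
assert (Eq : Series (fun n => a n * ((/ (e n + y)) ^ m - (/ (e n + x)) ^ m
     + INR m * (y - x) * (/ (e n + x)) ^ S m)) =
  pole_series a e m y - pole_series a e m x
    - (y - x) * (- INR m * pole_series a e (S m) x)).
{ unfold pole_series.
  replace (_ - (y - x) * _) with
    (Series (fun n => a n * (/ (e n + y)) ^ m) - Series (fun n => a n * (/ (e n + x)) ^ m)
     - (- INR m * (y - x)) * Series (fun n => a n * (/ (e n + x)) ^ S m)) by ring.
  rewrite <- Series_minus, <- Series_scal_l, <- Series_minus; [|..|easy|easy].
  2: exact (ex_series_minus (V := R_NormedModule) _ _ Ey Ex).
  2: exact (ex_series_scal_l (- INR m * (y - x)) _ Ex1).
  apply Series_ext; intros n; ring. }
rewrite <- Eq.
assert (abs : ex_series (fun n => Rabs (a n * ((/ (e n + y)) ^ m - (/ (e n + x)) ^ m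
     + INR m * (y - x) * (/ (e n + x)) ^ S m)))).
{ apply (@ex_series_le R_AbsRing R_CompleteNormedModule) with (2 := sB).
  intros n; change (norm ?u) with (Rabs u); rewrite Rabs_Rabsolu; apply T. }
eapply Rle_trans; [exact (Series_Rabs _ abs)|].
eapply Rle_trans; [apply (Series_le _ _ (fun n => conj (Rabs_pos _) (T n)) sB)|].
rewrite Series_scal_r; right; ring.
Qed.

Lemma pole_series_class a e m n :
  ex_series a -> (forall n, 0 <= a n) -> (forall n, 0 <= e n) ->
  class_on n pos_reals (pole_series a e m).
Proof.
intros sa a0 e0; revert m; induction n as [|n IH]; intros m.
- intros x x0; apply (is_derive_continuous _ x _ (pole_series_derive a e m x sa a0 e0 x0)).
- exists (fun x => - INR m * pole_series a e (S m) x); split.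
  + intros x x0; now apply pole_series_derive.
  + apply class_on_mult; [apply class_on_const|apply IH].
Qed.

Lemma Series_ge_term a n :
  (forall i, 0 <= a i) -> ex_series a -> a n <= Series a.
Proof.
intros a0 sa; rewrite (Series_incr_n a (S n)) by (lia || easy); simpl.
assert (P : a n <= sum_f_R0 a n).
{ destruct n as [|n]; simpl; [lra|].
  generalize (cond_pos_sum a n a0); lra. }
assert (0 <= Series (fun k => a (S (n + k)))); [|lra].
rewrite <- (Rmult_0_l (Series (fun k => a (S (n + k))))), <- Series_scal_l.
apply Series_le; [intros k; rewrite Rmult_0_l; split; [lra|easy]|].
exact (proj1 (ex_series_incr_n a (S n)) sa).
Qed.

Lemma pole_series_pos a e m x :
  ex_series a -> (forall n, 0 < a n) -> (forall n, 0 <= e n) -> 0 < x ->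
  0 < pole_series a e m x.
Proof.
intros sa a0 e0 x0.
assert (P : forall n, 0 < a n * (/ (e n + x)) ^ m).
{ intros n; apply Rmult_lt_0_compat; [easy|]; apply pow_lt.
  apply (pole_bound (e n) x x); [easy|easy|lra]. }
apply Rlt_le_trans with (1 := P 0%nat).
apply (Series_ge_term (fun n => a n * (/ (e n + x)) ^ m)).
- intros i; now apply Rlt_le.
- apply pole_series_ex; auto using Rlt_le.
Qed.

(** * A multiscale velocity *)

(** c n is the height and s n the slope of the n-th term of the velocity.  The
    ratio of consecutive heights makes the crossing time of each scale
    comparable to 1; the slopes are only bounded from below, which leaves room
    to make the scales shrink quickly. *)
Record scales (c s : nat -> R) : Prop := {
  scales_c : forall n, 0 < c n;
  scales_s : forall n, 16 <= s n;
  scales_cS : forall n, c (S n) = c n * exp (- (s n / 16));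
  scales_sS : forall n, 2 * s n <= s (S n)
}.

(** The abscissa at which the lines of slope s n and of height c n meet. *)
Definition scale (c s : nat -> R) (n : nat) : R := c n / s n.

Definition multiscale (c s : nat -> R) (x : R) : R :=
  Series (fun n => c n * x / (scale c s n + x)).

Lemma scale_pos c s n : scales c s -> 0 < scale c s n.
Proof.
intros H; apply Rdiv_lt_0_compat; [apply H|generalize (scales_s _ _ H n); lra].
Qed.

Lemma scales_c_half c s n : scales c s -> c (S n) <= c n / 2.
Proof.
intros H; rewrite (scales_cS _ _ H); apply Rmult_le_compat_l; [apply Rlt_le, H|].
rewrite exp_Ropp; apply Rinv_le_contravar; [lra|].
generalize (scales_s _ _ H n); intros s16.
generalize (exp_ineq1_le (s n / 16)); lra.
Qed.

Lemma scales_c_geom c s n k : scales c s -> c (n + k)%nat <= c n * (/ 2) ^ k.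
Proof.
intros H; induction k as [|k IH]; simpl; [rewrite Nat.add_0_r; lra|].
rewrite Nat.add_succ_r; generalize (scales_c_half c s (n + k) H); lra.
Qed.

Lemma half_lt_1 : Rabs (/ 2) < 1.
Proof. rewrite Rabs_right; lra. Qed.

Lemma scales_tail c s n :
  scales c s -> ex_series (fun k => c (n + k)%nat) /\ Series (fun k => c (n + k)%nat) <= 2 * c n.
Proof.
intros H; assert (G : ex_series (fun k => c n * (/ 2) ^ k))
  by exact (ex_series_scal_l (c n) _ (ex_series_geom _ half_lt_1)).
assert (B : forall k, 0 <= c (n + k)%nat <= c n * (/ 2) ^ k).
{ intros k; split; [apply Rlt_le, H|now apply scales_c_geom with s]. }
split.
- apply (@ex_series_le R_AbsRing R_CompleteNormedModule) with (2 := G).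
  intros k; change (Rabs (c (n + k)%nat) <= c n * (/ 2) ^ k).
  rewrite Rabs_right; [apply B|apply Rle_ge, B].
- eapply Rle_trans; [exact (Series_le _ _ B G)|].
  rewrite Series_scal_l, Series_geom by exact half_lt_1; lra.
Qed.

Lemma scales_summable c s : scales c s -> ex_series c.
Proof. exact (fun H => proj1 (scales_tail c s 0 H)). Qed.

(** The intermediate point c_(n+1) / s_n is where the n-th term overtakes the
    next one as the dominant part of the velocity. *)
Lemma scale_decreasing c s n : scales c s -> scale c s (S n) <= c (S n) / s n <= scale c s n.
Proof.
intros H; assert (s16 := scales_s _ _ H n); assert (s2 := scales_sS _ _ H n).
assert (cn := scales_c _ _ H n); assert (cS := scales_c _ _ H (S n)).
unfold scale, Rdiv; split.
- apply Rmult_le_compat_l; [lra|]; apply Rinv_le_contravar; lra.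
- apply Rmult_le_compat_r; [apply Rlt_le, Rinv_0_lt_compat; lra|].
  generalize (scales_c_half _ _ n H); lra.
Qed.

Lemma scale_le_scale_0 c s n : scales c s -> scale c s n <= scale c s 0.
Proof.
intros H; induction n as [|n IH]; [lra|].
generalize (scale_decreasing c s n H); lra.
Qed.

Lemma scale_small c s eps : scales c s -> 0 < eps -> exists n, scale c s n < eps.
Proof.
intros H e0; destruct (pow_lt_1_zero (/ 2) half_lt_1 (eps / c 0%nat)) as [n Hn].
{ apply Rdiv_lt_0_compat; [easy|apply H]. }
exists n; specialize (Hn n (Nat.le_refl n)).
assert (c0 := scales_c _ _ H 0); assert (cn := scales_c _ _ H n).
rewrite Rabs_right in Hn by (apply Rle_ge, pow_le; lra).
assert (G := scales_c_geom c s 0 n H); rewrite Nat.add_0_l in G.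
assert (s16 := scales_s _ _ H n).
apply Rle_lt_trans with (c n).
- unfold scale, Rdiv; rewrite <- (Rmult_1_r (c n)) at 2.
  apply Rmult_le_compat_l; [lra|].
  rewrite <- Rinv_1; apply Rinv_le_contravar; lra.
- apply Rle_lt_trans with (1 := G).
  replace eps with (c 0%nat * (eps / c 0%nat)) by (field; lra).
  now apply Rmult_lt_compat_l.
Qed.

Lemma scale_bracket c s x :
  scales c s -> 0 < x -> x <= scale c s 0 ->
  exists n, scale c s (S n) <= x <= scale c s n.
Proof.
intros H x0 xs; destruct (scale_small c s x H x0) as [N HN].
induction N as [|N IH]; [lra|].
destruct (Rle_or_lt x (scale c s N)) as [le|lt]; [exists N; lra|now apply IH].
Qed.

Lemma multiscale_term_bounds c s n x :
  scales c s -> 0 <= x ->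
  0 <= c n * x / (scale c s n + x) /\
  c n * x / (scale c s n + x) <= c n /\
  c n * x / (scale c s n + x) <= s n * x.
Proof.
intros H x0; assert (e0 := scale_pos c s n H); assert (c0 := scales_c _ _ H n).
assert (s16 := scales_s _ _ H n).
assert (E : c n = s n * scale c s n) by (unfold scale; field; lra).
assert (i0 : 0 < / (scale c s n + x)) by (apply Rinv_0_lt_compat; lra).
repeat split.
- apply Rmult_le_pos; [apply Rmult_le_pos|]; lra.
- apply Rle_div_l; [lra|nra].
- apply Rle_div_l; [lra|]; rewrite E; nra.
Qed.

Lemma multiscale_ex_series c s x :
  scales c s -> 0 <= x -> ex_series (fun n => c n * x / (scale c s n + x)).
Proof.
intros H x0; apply (@ex_series_le R_AbsRing R_CompleteNormedModule) with c.
- intros n; change (Rabs (c n * x / (scale c s n + x)) <= c n).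
  destruct (multiscale_term_bounds c s n x H x0) as [b1 [b2 _]].
  rewrite Rabs_right; lra.
- now apply scales_summable with s.
Qed.

Lemma multiscale_bounded c s x :
  scales c s -> 0 <= x -> multiscale c s x <= Series c.
Proof.
intros H x0; apply Series_le; [|now apply scales_summable with s].
intros n; destruct (multiscale_term_bounds c s n x H x0) as [b1 [b2 _]]; lra.
Qed.

(** Terms up to n are linear with slopes at least doubling, the later ones are
    bounded by heights at least halving; each group is dominated by twice its
    largest member. *)
Lemma multiscale_le c s n x :
  scales c s -> 0 <= x -> multiscale c s x <= 2 * s n * x + 2 * c (S n).
Proof.
intros H x0; unfold multiscale.
rewrite (Series_incr_n _ (S n)) by (lia || now apply multiscale_ex_series).
apply Rplus_le_compat; simpl.
- induction n as [|n IH]; simpl.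
  + destruct (multiscale_term_bounds c s 0 x H x0) as [_ [_ b]].
    generalize (Rmult_le_compat_r x _ _ x0 (scales_s _ _ H 0)); lra.
  + destruct (multiscale_term_bounds c s (S n) x H x0) as [_ [_ b]].
    generalize (Rmult_le_compat_r x _ _ x0 (scales_sS _ _ H n)); lra.
- destruct (scales_tail c s (S n) H) as [T1 T2].
  eapply Rle_trans; [|exact T2]; apply Series_le; [|exact T1].
  intros k; destruct (multiscale_term_bounds c s (S n + k) x H x0) as [b1 [b2 _]].
  simpl in *; lra.
Qed.

Lemma multiscale_ge c s n x :
  scales c s -> 0 <= x -> c n * x / (scale c s n + x) <= multiscale c s x.
Proof.
intros H x0; apply (Series_ge_term (fun n => c n * x / (scale c s n + x))).
- intros i; now apply multiscale_term_bounds.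
- now apply multiscale_ex_series.
Qed.

(** Since c x / (e + x) = c - c e / (e + x), the velocity is a constant minus a
    pole series of order 1, and pole series describe its derivatives. *)
Lemma multiscale_poles c s x :
  scales c s -> 0 < x ->
  Series c - pole_series (fun n => c n * scale c s n) (scale c s) 1 x = multiscale c s x.
Proof.
intros H x0; unfold pole_series; rewrite <- Series_minus.
- apply Series_ext; intros n; simpl.
  generalize (scale_pos c s n H); intros e0; field; lra.
- now apply scales_summable with s.
- apply (@ex_series_le R_AbsRing R_CompleteNormedModule) with c;
    [|now apply scales_summable with s].
  intros n; change (Rabs (c n * scale c s n * (/ (scale c s n + x)) ^ 1) <= c n).
  generalize (scale_pos c s n H) (scales_c _ _ H n); intros e0 c0.
  assert (i0 : 0 < / (scale c s n + x)) by (apply Rinv_0_lt_compat; lra).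
  replace (_ ^ 1) with (/ (scale c s n + x)) by ring.
  rewrite Rabs_right.
  + apply Rle_div_l; [lra|nra].
  + apply Rle_ge, Rmult_le_pos; [apply Rmult_le_pos|]; lra.
Qed.

Lemma multiscale_velocity c s : scales c s ->
  velocity (multiscale c s)
    (pole_series (fun n => c n * scale c s n) (scale c s) 2)
    (fun x => - 2 * pole_series (fun n => c n * scale c s n) (scale c s) 3 x).
Proof.
intros H; set (a := fun n => c n * scale c s n).
assert (a0 : forall n, 0 < a n).
{ intros n; apply Rmult_lt_0_compat; [apply H|now apply scale_pos]. }
assert (a1 : forall n, 0 <= a n) by (intros n; apply Rlt_le, a0).
assert (e0 : forall n, 0 <= scale c s n) by (intros n; now apply Rlt_le, scale_pos).
assert (sa : ex_series a).
{ apply (@ex_series_le R_AbsRing R_CompleteNormedModule) with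
    (fun n => c n * scale c s 0).
  - intros n; change (Rabs (a n) <= c n * scale c s 0).
    rewrite Rabs_right by apply Rle_ge, a1.
    apply Rmult_le_compat_l; [apply Rlt_le, H|now apply scale_le_scale_0].
  - apply (ex_series_scal_r (scale c s 0)); now apply scales_summable with s. }
assert (loc : forall x, 0 < x -> locally x (fun y =>
  Series c - pole_series a (scale c s) 1 y = multiscale c s y)).
{ intros x x0; apply (locally_on _ _ x (open_pos_reals x x0)); intros y y0.
  now apply multiscale_poles. }
split.
- transitivity (0 * Series c); [|ring].
  rewrite <- Series_scal_l; apply Series_ext; intros n; generalize (scale_pos c s n H); intros; field; lra.
- intros x x0; eapply Rlt_le_trans; [|apply (multiscale_ge c s 0); [easy|lra]].
  generalize (scale_pos c s 0 H) (scales_c _ _ H 0); intros.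
  apply Rdiv_lt_0_compat; [apply Rmult_lt_0_compat|]; lra.
- intros x x0.
  apply (is_derive_ext_loc _ _ _ _ (loc x x0)).
  replace (pole_series a _ 2 x) with (0 - (- INR 1 * pole_series a (scale c s) 2 x))
    by (simpl; ring).
  apply (is_derive_minus (fun _ => Series c) (pole_series a (scale c s) 1) x).
  + exact (is_derive_const (Series c) x).
  + now apply pole_series_derive.
- intros x x0; replace (- 2) with (- INR 2) by (simpl; ring).
  now apply pole_series_derive.
- intros x x0; now apply pole_series_pos.
- intros x x0; generalize (pole_series_pos a (scale c s) 3 x sa a0 e0 x0); lra.
- intros n; apply class_on_ext with
    (fun y => Series c + - 1 * pole_series a (scale c s) 1 y); [apply open_pos_reals| |].
  + intros y y0; rewrite <- multiscale_poles by easy; unfold a; ring.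
  + apply class_on_plus; [apply class_on_const|].
    apply class_on_mult; [apply class_on_const|now apply pole_series_class].
- intros eps eps0.
  (* Choose n so that the heights beyond n contribute at most eps / 2, then x so
     small that the lines up to n do too. *)
  destruct (pow_lt_1_zero (/ 2) half_lt_1 (eps / (4 * c 0%nat))) as [n Hn].
  { apply Rdiv_lt_0_compat; [easy|]; generalize (scales_c _ _ H 0); lra. }
  specialize (Hn (S n) (Nat.le_succ_diag_r n)).
  assert (c0 := scales_c _ _ H 0).
  rewrite Rabs_right in Hn by (apply Rle_ge, pow_le; lra).
  assert (G := scales_c_geom c s 0 (S n) H); rewrite Nat.add_0_l in G.
  apply (Rmult_lt_compat_l (c 0%nat)) in Hn; [|easy].
  replace (c 0%nat * (eps / _)) with (eps / 4) in Hn by (field; lra).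
  assert (s16 := scales_s _ _ H n).
  exists (eps / (4 * s n)); split; [apply Rdiv_lt_0_compat; lra|].
  intros x [x0 xe]; apply Rle_lt_trans with (1 := multiscale_le c s n x H (Rlt_le _ _ x0)).
  apply (Rmult_lt_compat_l (s n)) in xe; [|lra].
  replace (s n * (eps / _)) with (eps / 4) in xe by (field; lra).
  lra.
Qed.

(** * Crossing times *)

Lemma ln_scale_ratio c s n :
  scales c s -> ln (scale c s n) - ln (c (S n) / s n) = s n / 16.
Proof.
intros H; assert (s16 := scales_s _ _ H n); assert (cn := scales_c _ _ H n).
replace (scale c s n) with (c (S n) / s n * exp (s n / 16)).
- rewrite ln_mult; [rewrite ln_exp; ring| |apply exp_pos].
  apply Rdiv_lt_0_compat; [apply H|lra].
- rewrite (scales_cS _ _ H), exp_Ropp; unfold scale; field.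
  split; [lra|]; generalize (exp_pos (s n / 16)); lra.
Qed.

Lemma is_derive_scaled_ln C x : 0 < x -> is_derive (fun z => C * ln z) x (C / x).
Proof. intros x0; auto_derive; [easy|field; lra]. Qed.

Lemma is_derive_scaled_id C x : is_derive (fun z => C * z) x C.
Proof. auto_derive; [easy|ring]. Qed.

(** Below c_(n+1) / s_n the height c_(n+1) / 2 bounds the velocity from below,
    and this stretch takes at most 2 / s_n <= 1/8; above it the slope s_n / 2
    does, and takes at most (2 / s_n) (s_n / 16) = 1/8. *)
Lemma crossing_time_le c s (T : R -> R) n :
  scales c s -> (forall x, 0 < x -> is_derive T x (/ multiscale c s x)) ->
  T (scale c s n) - T (scale c s (S n)) <= / 4.
Proof.
intros H dT; assert (s16 := scales_s _ _ H n).
assert (cn := scales_c _ _ H n); assert (cS := scales_c _ _ H (S n)).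
assert (p := scale_pos c s (S n) H); assert (d := scale_decreasing c s n H).
set (r := c (S n) / s n) in *.
assert (low : T r - T (scale c s (S n)) <= 2 / c (S n) * r - 2 / c (S n) * scale c s (S n)).
{ apply (increment_le T (fun z => 2 / c (S n) * z) (fun z => / multiscale c s z)
    (fun _ => 2 / c (S n))); [easy| | |].
  - intros z Hz; apply dT; lra.
  - intros z Hz; apply is_derive_scaled_id.
  - intros z Hz; replace (2 / c (S n)) with (/ (c (S n) / 2)) by (field; lra).
    apply Rinv_le_contravar; [lra|].
    eapply Rle_trans; [|apply (multiscale_ge c s (S n)); [easy|lra]].
    apply (proj1 (Rle_div_r _ _ (scale c s (S n) + z) ltac:(lra))).
    assert (0 <= c (S n) * (z - scale c s (S n))) by (apply Rmult_le_pos; lra); lra. }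
assert (high : T (scale c s n) - T r <= 2 / s n * ln (scale c s n) - 2 / s n * ln r).
{ apply (increment_le T (fun z => 2 / s n * ln z) (fun z => / multiscale c s z)
    (fun z => 2 / s n / z)); [easy| | |].
  - intros z Hz; apply dT; lra.
  - intros z Hz; apply is_derive_scaled_ln; lra.
  - intros z Hz; replace (2 / s n / z) with (/ (s n * z / 2)) by (field; lra).
    apply Rinv_le_contravar; [nra|].
    eapply Rle_trans; [|apply (multiscale_ge c s n); [easy|lra]].
    apply (proj1 (Rle_div_r _ _ (scale c s n + z) ltac:(lra))).
    replace (c n) with (s n * scale c s n) by (unfold scale; field; lra).
    apply Rle_trans with (s n * z / 2 * (2 * scale c s n)); [|right; field].
    apply Rmult_le_compat_l; [nra|lra]. }
rewrite <- Rmult_minus_distr_l in high.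
unfold r in high at 2; rewrite ln_scale_ratio in high by easy.
replace (2 / s n * (s n / 16)) with (/ 8) in high by (field; lra).
assert (2 / c (S n) * r <= / 8).
{ unfold r; replace (_ * _) with (2 * / s n) by (field; lra).
  generalize (Rinv_le_contravar 16 (s n) ltac:(lra) s16); lra. }
assert (0 < 2 / c (S n) * scale c s (S n)); [|lra].
apply Rmult_lt_0_compat; [apply Rdiv_lt_0_compat; lra|easy].
Qed.

(** Above c_(n+1) / s_n the velocity is at most 4 s_n x, and the logarithm of the
    ratio of the endpoints is s_n / 16. *)
Lemma crossing_time_ge c s (T : R -> R) n :
  scales c s -> (forall x, 0 < x -> is_derive T x (/ multiscale c s x)) ->
  / 64 <= T (scale c s n) - T (scale c s (S n)).
Proof.
intros H dT; assert (s16 := scales_s _ _ H n).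
assert (cn := scales_c _ _ H n); assert (cS := scales_c _ _ H (S n)).
assert (p := scale_pos c s (S n) H); assert (d := scale_decreasing c s n H).
set (r := c (S n) / s n) in *.
assert (mp := velocity_pos _ _ _ (multiscale_velocity c s H)).
assert (low : 0 * r - 0 * scale c s (S n) <= T r - T (scale c s (S n))).
{ apply (increment_le (fun z => 0 * z) T (fun _ => 0) (fun z => / multiscale c s z));
    [easy| | |].
  - intros z Hz; apply is_derive_scaled_id.
  - intros z Hz; apply dT; lra.
  - intros z Hz; apply Rlt_le, Rinv_0_lt_compat, mp; lra. }
assert (high : / (4 * s n) * ln (scale c s n) - / (4 * s n) * ln r <= T (scale c s n) - T r).
{ apply (increment_le (fun z => / (4 * s n) * ln z) T (fun z => / (4 * s n) / z)
    (fun z => / multiscale c s z)); [easy| | |].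
  - intros z Hz; apply is_derive_scaled_ln; lra.
  - intros z Hz; apply dT; lra.
  - intros z Hz; replace (/ (4 * s n) / z) with (/ (4 * (s n * z))) by (field; lra).
    apply Rinv_le_contravar; [apply mp; lra|].
    eapply Rle_trans; [apply (multiscale_le c s n); [easy|lra]|].
    assert (c (S n) <= s n * z); [|lra].
    replace (c (S n)) with (s n * r) by (unfold r; field; lra).
    apply Rmult_le_compat_l; lra. }
rewrite <- Rmult_minus_distr_l in high.
unfold r in high at 1; rewrite ln_scale_ratio in high by easy.
replace (/ (4 * s n) * (s n / 16)) with (/ 64) in high by (field; lra).
lra.
Qed.

(** Each of the infinitely many scales takes at least 1/64 to cross, so T tends to
    -oo at 0; the velocity is bounded, so T tends to +oo at infinity. *)
Lemma multiscale_time_chart c s :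
  scales c s -> exists T h, time_chart (multiscale c s) T h.
Proof.
intros H; assert (Hmu := multiscale_velocity c s H).
assert (mp := velocity_pos _ _ _ Hmu).
assert (cont : forall x, 0 < x -> continuous (fun z => / multiscale c s z) x).
{ intros x x0; apply (class_on_continuous 0 pos_reals); [|easy].
  apply class_on_inv; [|apply Hmu].
  intros z z0; generalize (mp z z0); lra. }
set (T := fun x => RInt (fun z => / multiscale c s z) 1 x).
assert (dT : forall x, 0 < x -> is_derive T x (/ multiscale c s x)).
{ intros x x0; apply (is_derive_RInt (fun z => / multiscale c s z) T 1 x);
    [|now apply cont].
  apply (locally_on _ _ x (open_pos_reals x x0)); intros y y0.
  apply (RInt_correct (V := R_CompleteNormedModule)), ex_RInt_continuous.
  intros z Hz; apply cont.
  generalize (Rmin_glb_lt 1 y 0 Rlt_0_1 y0); lra. }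
exists T; apply time_chart_exists; [easy| |].
- assert (L : forall n, T (scale c s n) <= T (scale c s 0) - INR n * / 64).
  { induction n as [|n IH]; [simpl; lra|].
    generalize (crossing_time_ge c s T n H dT); rewrite S_INR; lra. }
  intros M; destruct (INR_unbounded (64 * (T (scale c s 0) - M))) as [n Hn].
  exists (scale c s n); split; [now apply scale_pos|].
  generalize (L n); lra.
- intros M; assert (S0 : 0 < Series c).
  { apply Rlt_le_trans with (c 0%nat); [apply H|].
    apply Series_ge_term; [intros i; apply Rlt_le, H|now apply scales_summable with s]. }
  set (K := Series c * Rmax 0 (M - T 1)).
  assert (K0 : 0 <= K) by (apply Rmult_le_pos; [lra|apply Rmax_l]).
  (* The velocity is at most the sum of the heights, so covering the distance K
     takes at least M - T 1. *)
  exists (1 + K); split; [lra|].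
  assert (I : / Series c * (1 + K) - / Series c * 1 <= T (1 + K) - T 1).
  { apply (increment_le (fun z => / Series c * z) T (fun _ => / Series c)
      (fun z => / multiscale c s z)); [lra| | |].
    - intros z Hz; apply is_derive_scaled_id.
    - intros z Hz; apply dT; lra.
    - intros z Hz; apply Rinv_le_contravar; [apply mp; lra|].
      apply multiscale_bounded; [easy|lra]. }
  replace (_ - _) with (Rmax 0 (M - T 1)) in I at 1 by (unfold K; field; lra).
  generalize (Rmax_r 0 (M - T 1)); lra.
Qed.

(** Unless y <= x, the point x lies between two consecutive scales, and y is at
    most one scale further up: two crossings, hence time at most 1/2 < 1. *)
Lemma flow_outpaces c s T h x y :
  scales c s -> time_chart (multiscale c s) T h -> 0 < x -> y <= scale c s 0 ->
  (forall n, x <= scale c s (S n) -> y <= scale c s n) -> y < flow T h 1 x.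
Proof.
intros H HT x0 ys Hxy; assert (Hmu := multiscale_velocity c s H).
destruct (Rle_or_lt y x) as [yx|xy].
{ apply Rle_lt_trans with (1 := yx).
  apply (flow_gt _ _ _ _ _ 1 x Hmu HT); lra. }
rewrite flow_pos_eq by easy.
apply (chart_lt_inv _ _ _ _ _ _ _ Hmu HT); [lra|apply HT|].
rewrite (chart_time _ _ _ HT).
assert (le : forall u v, 0 < u -> u <= v -> T u <= T v).
{ intros u v u0 [uv| ->]; [|lra].
  generalize (chart_lt _ _ _ _ _ _ _ Hmu HT u0 uv); lra. }
assert (cr : forall n, T (scale c s n) - T (scale c s (S n)) <= / 4).
{ intros n; apply crossing_time_le; [easy|apply HT]. }
destruct (scale_bracket c s x H x0 ltac:(lra)) as [[|n] [lo up]].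
- generalize (le _ _ (scale_pos c s 1 H) lo) (le y _ ltac:(lra) ys) (cr 0%nat); lra.
- generalize (le _ _ (scale_pos c s (S (S n)) H) lo)
    (le y _ ltac:(lra) (Hxy n up)) (cr n) (cr (S n)); lra.
Qed.

(** The pairs (c n, s n) are produced by iteration: the next height is prescribed,
    and then the slope is taken so large that the next scale fits under delta. *)
Lemma scales_exist (B : R) (delta : R -> R) :
  0 < B -> (forall eps, 0 < eps -> 0 < delta eps) ->
  exists c s, scales c s /\ scale c s 0 = B /\
    forall n, scale c s (S n) <= delta (scale c s n).
Proof.
intros B0 d0.
set (step := fun p : R * R => let c' := fst p * exp (- (snd p / 16)) in
  (c', Rmax (2 * snd p) (c' / delta (fst p / snd p)))).
set (p := fun n => Nat.iter n step (16 * B, 16)).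
assert (P : forall n, 0 < fst (p n) /\ 16 <= snd (p n)).
{ induction n as [|n [c0 s16]]; [simpl; lra|]; split.
  - change (0 < fst (p n) * exp (- (snd (p n) / 16))).
    apply Rmult_lt_0_compat; [easy|apply exp_pos].
  - change (16 <= Rmax (2 * snd (p n)) (fst (p (S n)) / delta (fst (p n) / snd (p n)))).
    eapply Rle_trans; [|apply Rmax_l]; lra. }
assert (Q : forall n, snd (p (S n)) =
  Rmax (2 * snd (p n)) (fst (p (S n)) / delta (fst (p n) / snd (p n)))) by easy.
exists (fun n => fst (p n)), (fun n => snd (p n)); split; [split|split].
- intros n; apply P.
- intros n; apply P.
- intros n; reflexivity.
- intros n; rewrite Q; apply Rmax_l.
- unfold scale; simpl; field.
- intros n; unfold scale; destruct (P n) as [c0 s16], (P (S n)) as [c1 s1].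
  set (d := delta (fst (p n) / snd (p n))).
  assert (dp : 0 < d) by (apply d0, Rdiv_lt_0_compat; lra).
  apply Rle_div_l; [lra|].
  assert (le : fst (p (S n)) / d <= snd (p (S n))) by (rewrite Q; apply Rmax_r).
  apply Rle_div_l in le; [lra|easy].
Qed.

(** * The embedding theorem *)

Theorem theorem9p12 (k : nat) (f : R -> R)
  (hk : (3 <= k)%nat)
  (hf : is_Ck_MOC k f)
  (hconc : globally_concave f)
  (hacc : globally_acceptable f)
  (a : R) (ha : 0 < a) :
  exists (fbar : R -> R) (G : R -> R -> R) (mu : R -> R),
    (is_Ck_MOC (k + 1) fbar /\ globally_concave fbar /\ globally_acceptable fbar) /\
    (is_Ck_CIG (k + 1) G /\ CIG_globally_concave G /\ CIG_globally_acceptable G) /\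
    embedded_in fbar G /\
    (forall x, 0 < x < a -> f x < fbar x) /\
    (is_CIG_velocity G mu /\ concave_on pos_reals mu /\ Ck_half_line k mu) /\
    ((exists h, is_generating_function G h) /\
     (forall h, is_generating_function G h -> Ck_on (k + 1) (fun _ => True) h)) /\
    (strongly_strictly_concave_on pos_reals f ->
     strongly_strictly_concave_on (interval_oo 0 a) mu).
Proof.
assert (fa : a < f a) by now apply hacc.
destruct (MOC_small f (proj1 hf)) as [delta Hdelta].
destruct (scales_exist (f a) delta) as [c [s [H [H0 HS]]]];
  [lra|now intros eps e0; apply Hdelta|].
assert (Hmu := multiscale_velocity c s H).
destruct (multiscale_time_chart c s H) as [T [h HT]].
destruct (second_derivative pos_reals _ _ _ open_pos_reals
  (velocity_derive _ _ _ Hmu) (velocity_derive_2 _ _ _ Hmu)) as [twice second].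
exists (flow T h 1), (flow T h), (multiscale c s).
split; [|split; [|split; [|split; [|split; [|split]]]]].
- split; [|split].
  + exact (flow_Ck_MOC _ _ _ _ _ 1 _ Hmu HT).
  + exact (flow_concave _ _ _ _ _ 1 Hmu HT Rlt_0_1).
  + exact (flow_acceptable _ _ _ _ _ 1 Hmu HT Rlt_0_1).
- split; [split|split].
  + exact (flow_CIG _ _ _ _ _ Hmu HT).
  + intros t; exact (flow_Ck_MOC _ _ _ _ _ t _ Hmu HT).
  + exact (flow_globally_concave _ _ _ _ _ Hmu HT).
  + exact (flow_globally_acceptable _ _ _ _ _ Hmu HT).
- easy.
- intros x [x0 xa]; apply (flow_outpaces c s); [easy|easy|easy| |].
  + rewrite H0; apply Rlt_le, globally_acceptable_lt; [easy|lra|easy].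
  + intros n xn; apply (Hdelta (scale c s n)); [now apply scale_pos|].
    generalize (HS n); lra.
- split; [|split; [|split]].
  + exact (flow_velocity _ _ _ _ _ Hmu HT).
  + split; [exact twice|]; intros x x0; rewrite second by easy.
    now apply Rlt_le, (velocity_concave _ _ _ Hmu).
  + apply is_MOC_of_limit; try apply Hmu.
    * intros x x0; exact (class_on_continuous 0 _ _ _ (velocity_class _ _ _ Hmu 0) x0).
    * intros x x0; now apply Rlt_le, Hmu.
  + apply class_on_Ck_on; [apply open_pos_reals|apply Hmu].
- split; [exists h; exact (flow_generating _ _ _ _ _ Hmu HT)|].
  intros g; exact (generating_function_class _ _ _ _ _ g _ Hmu HT).
- intros _; split.
  + intros x [x0 _]; now apply twice.
  + intros x [x0 _]; rewrite second by easy; now apply (velocity_concave _ _ _ Hmu).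
Qed.
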